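(* Let $\Lambda$ be an arbitrary ring and $A$ a finitely presented right $\Lambda$-module. Then $\mathfrak{s}(A)=\mathfrak{t}(A)$ as submodules of $A$, where $\mathfrak{s}$ is the injective torsion and $\mathfrak{t}$ is the Bass torsion.
   Context: $\Lambda$ is an arbitrary ring with identity and $\iota:\Lambda\to I$ is the injective envelope of $\Lambda$ viewed as a left $\Lambda$-module. For a right $\Lambda$-module $A$, the injective torsion is $\mathfrak{s}(A):=\ker\big(1\otimes\iota: A\otimes_\Lambda\Lambda\to A\otimes_\Lambda I\big)$, identified with a submodule of $A$ via $A\otimes_\Lambda\Lambda\cong A$. The Bass torsion of $A$ is $\mathfrak{t}(A):=\ker(e_A:A\to A^{**})$, where $A^*:=\mathrm{Hom}_\Lambda(A,\Lambda)$ and $e_A$ is the canonical evaluation map. *)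

(* Defs.v *)
From HB Require Import structures.
From mathcomp Require Import all_boot all_algebra.
From mathcomp Require Import generic_quotient ring_quotient.
From mathcomp Require Import boolp classical_sets.
From mathcomp Require Import freeg.

Set Implicit Arguments.
Unset Strict Implicit.
Unset Printing Implicit Defensive.
Import GRing.Theory.
Local Open Scope ring_scope.
Local Open Scope quotient_scope.
Local Open Scope classical_set_scope.

(* [pzRingType] is used throughout so that the zero ring is allowed.  A left
   R-module is an [lmodType R]; a right R-module is an [lmodType R^c], the
   product a r being [(r : R^c) *: a].  In particular [R^o] is R as a left
   module and [R^c^o] is R as a right module. *)

Section Span.
Variables (G : zmodType) (P : set G).

(* The subgroup generated by P. *)
Definition zspan : {pred G} := fun x => `[<forall S : {pred G},
  GRing.zmod_closed S -> (forall y, P y -> y \in S) -> x \in S>].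

Fact zspan_closed : GRing.zmod_closed zspan.
Proof.
split=> [|x y /asboolP xS /asboolP yS]; apply/asboolP => S clS PS.
  by case: clS.
by case: (clS) => _; apply; [apply: xS | apply: yS].
Qed.
HB.instance Definition _ := GRing.isZmodClosed.Build G zspan zspan_closed.

Lemma zspan_gen x : P x -> x \in zspan.
Proof. by move=> Px; apply/asboolP => S _; apply. Qed.

Lemma zspan_ker (H : zmodType) (f : {additive G -> H}) x :
  (forall y, P y -> f y = 0) -> x \in zspan -> f x = 0.
Proof.
move=> fP /asboolP /(_ [pred z | f z == 0]) xS; apply/eqP/xS.
  split=> [|u v]; rewrite !inE ?raddf0 // => /eqP fu /eqP fv.
  by rewrite raddfB fu fv subrr.
by move=> y Py; rewrite inE fP.
Qed.

End Span.

Section Tensor.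
Variables (R : pzRingType) (A : lmodType R^c) (M : lmodType R).

Variant tensor_rel : {freeg (A * M)%type / int} -> Prop :=
| TensorDl a a' m :
    tensor_rel (<<(a + a', m)>> - <<(a, m)>> - <<(a', m)>>)
| TensorDr a m m' :
    tensor_rel (<<(a, m + m')>> - <<(a, m)>> - <<(a, m')>>)
| TensorZ a (r : R) m :
    tensor_rel (<<((r : R^c) *: a, m)>> - <<(a, r *: m)>>).

Definition tensor : Type := Quotient.quot (zspan tensor_rel).
HB.instance Definition _ := GRing.Zmodule.on tensor.

Definition tens (a : A) (m : M) : tensor := \pi_tensor <<(a, m)>>.

Fact tensor_pi_is_additive : zmod_morphism (\pi_tensor : _ -> tensor).
Proof. by move=> x y; rewrite [LHS]pi_addr pi_oppr. Qed.
HB.instance Definition _ :=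
  GRing.isZmodMorphism.Build _ tensor \pi_tensor tensor_pi_is_additive.

Lemma tensor_pi_eq0 x : (\pi_tensor x == 0 :> tensor) = (x \in zspan tensor_rel).
Proof. by rewrite -[x in RHS]subr0 Quotient.idealrBE -[0 in LHS](raddf0 \pi_tensor). Qed.

Lemma tensDl a a' m : tens (a + a') m = tens a m + tens a' m.
Proof.
apply/eqP; rewrite -subr_eq0 opprD addrA -!raddfB tensor_pi_eq0.
exact/zspan_gen/TensorDl.
Qed.

Lemma tensDr a m m' : tens a (m + m') = tens a m + tens a m'.
Proof.
apply/eqP; rewrite -subr_eq0 opprD addrA -!raddfB tensor_pi_eq0.
exact/zspan_gen/TensorDr.
Qed.

Lemma tensZ a (r : R) m : tens ((r : R^c) *: a) m = tens a (r *: m).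
Proof.
apply/eqP; rewrite -subr_eq0 -raddfB tensor_pi_eq0.
exact/zspan_gen/TensorZ.
Qed.

Lemma tensor_ext (G : zmodType) (f g : {additive tensor -> G}) :
  (forall a m, f (tens a m) = g (tens a m)) -> f =1 g.
Proof.
move=> fg t; rewrite -[t]reprK; elim/freeg_ind_dom0: (repr t) => [|k [a m] D _ _ IH].
  by rewrite !raddf0.
rewrite !raddfD IH; congr (_ + _).
have -> : <<k *g (a, m)>> = <<(a, m)>> *~ k.
  by rewrite freegU_mulz intz.
by rewrite !raddfMz fg.
Qed.

Section Lift.
Variables (G : zmodType) (b : A -> M -> G).

Definition balanced : Prop :=
  [/\ forall a a' m, b (a + a') m = b a m + b a' m,
      forall a m m', b a (m + m') = b a m + b a m'
    & forall a (r : R) m, b ((r : R^c) *: a) m = b a (r *: m)].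

(* The additive map sending [tens a m] to [b a m], when b is balanced. *)
Definition tensor_lift (t : tensor) : G :=
  fglift (fun p : A * M => b p.1 p.2 : zmodule G) (repr t).

Hypothesis bal : balanced.

Lemma tensor_lift_pi x : tensor_lift (\pi_tensor x) =
  fglift (fun p : A * M => b p.1 p.2 : zmodule G) x.
Proof.
pose F := fglift (fun p : A * M => b p.1 p.2 : zmodule G).
have addF : zmod_morphism F by exact: lift_is_additive.
pose FA := GRing.isZmodMorphism.Build _ _ F addF.
pose Fa : {additive _ -> _} := HB.pack F FA.
have FU a m : Fa <<(a, m)>> = b a m by rewrite /Fa /= /F liftU scale1r.
apply/eqP; rewrite -subr_eq0 -[_ - _]/(Fa _ - Fa _) -raddfB; apply/eqP.
case: bal => bl br bz; apply: (@zspan_ker _ tensor_rel).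
  move=> _ [a a' m|a m m'|a r m]; rewrite !raddfB !FU.
  - by rewrite bl addrAC addrK subrr.
  - by rewrite br addrAC addrK subrr.
  - by rewrite bz subrr.
by rewrite -tensor_pi_eq0 raddfB /= reprK subrr.
Qed.

Lemma tensor_liftE a m : tensor_lift (tens a m) = b a m.
Proof. by rewrite tensor_lift_pi liftU scale1r. Qed.

Lemma tensor_lift_is_additive : zmod_morphism tensor_lift.
Proof.
move=> s t; rewrite -[s]reprK -[t]reprK -raddfB !tensor_lift_pi.
exact: (@lift_is_additive _ _ (zmodule G) (fun p : A * M => b p.1 p.2)).
Qed.

End Lift.
End Tensor.

Section TensorMap.
Variables (R : pzRingType) (A : lmodType R^c).

Section Map.
Variables (M N : lmodType R) (f : {linear M -> N}).

(* 1 (x) f : A (x) M -> A (x) N *)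
Definition tensor_map : tensor A M -> tensor A N :=
  tensor_lift (fun a m => tens a (f m)).

Fact tensor_map_balanced :
  balanced (fun (a : A) (m : M) => tens a (f m)).
Proof.
split=> [a a' m|a m m'|a r m]; first exact: tensDl.
  by rewrite linearD tensDr.
by rewrite linearZ tensZ.
Qed.

Lemma tensor_mapE a m : tensor_map (tens a m) = tens a (f m).
Proof. exact: tensor_liftE tensor_map_balanced _ _. Qed.

HB.instance Definition _ := GRing.isZmodMorphism.Build _ _ tensor_map
  (tensor_lift_is_additive tensor_map_balanced).
End Map.

(* The canonical isomorphism A (x) R -> A, a (x) r |-> a r. *)
Definition tensor_unit : tensor A R^o -> A :=
  tensor_lift (fun a (r : R^o) => (r : R^c) *: a).

Fact tensor_unit_balanced : balanced (fun (a : A) (r : R^o) => (r : R^c) *: a).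
Proof.
split=> [a a' r|a r r'|a r s]; first exact: scalerDr.
  exact: (@scalerDl R^c A).
by rewrite scalerA.
Qed.

Lemma tensor_unitE a (r : R) : tensor_unit (tens a (r : R^o)) = (r : R^c) *: a.
Proof. exact: tensor_liftE tensor_unit_balanced _ _. Qed.

HB.instance Definition _ := GRing.isZmodMorphism.Build _ _ tensor_unit
  (tensor_lift_is_additive tensor_unit_balanced).

Lemma tensor_unit_bij : bijective tensor_unit.
Proof.
pose g (a : A) := tens a (1 : R^o).
have addg : zmod_morphism g.
  by move=> x y; apply/eqP; rewrite eq_sym subr_eq /g -tensDl addrNK.
exists g => [t|a]; last by rewrite tensor_unitE scale1r.
pose gA := GRing.isZmodMorphism.Build _ _ g addg.
pose ga : {additive _ -> _} := HB.pack g gA.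
apply: (@tensor_ext _ _ _ _ (ga \o tensor_unit) idfun) => a r /=.
by rewrite tensor_unitE /ga /= /g tensZ; congr tens; rewrite /GRing.scale /= mulr1.
Qed.

(* ker (1 (x) iota), viewed inside A along [tensor_unit]. *)
Definition injective_torsion (I : lmodType R) (iota : {linear R^o -> I}) : set A :=
  tensor_unit @` [set t | tensor_map iota t = 0].

End TensorMap.

Arguments injective_torsion {R} A {I} iota.

Section Dual.
Variables (S : pzRingType) (V : lmodType S).

(* Hom_S(V, S), for a left module V over S. *)
Definition dual : Type := {linear V -> S^o}.
Identity Coercion linear_of_dual : dual >-> GRing.Linear.type.
HB.instance Definition _ := gen_eqMixin dual.
HB.instance Definition _ := gen_choiceMixin dual.

Lemma dualP (f g : dual) : (forall v, f v = g v) -> f = g.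
Proof.
case: f => [f [[cf1] [cf2]]]; case: g => [g [[cg1] [cg2]]] /= fg.
have efg : f = g by apply/funext.
by subst g; rewrite (Prop_irrelevance cf1 cg1) (Prop_irrelevance cf2 cg2).
Qed.

Definition dual_zero : dual := (\0 : V -> S^o).
Definition dual_opp (f : dual) : dual := (\- f : V -> S^o).
Definition dual_add (f g : dual) : dual := (f \+ g : V -> S^o).

Fact dual_addA : associative dual_add.
Proof. by move=> f g h; apply: dualP => v; apply: addrA. Qed.
Fact dual_addC : commutative dual_add.
Proof. by move=> f g; apply: dualP => v; apply: addrC. Qed.
Fact dual_add0 : left_id dual_zero dual_add.
Proof. by move=> f; apply: dualP => v; apply: add0r. Qed.
Fact dual_addN : left_inverse dual_zero dual_opp dual_add.
Proof. by move=> f; apply: dualP => v; apply: addNr. Qed.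
HB.instance Definition _ :=
  GRing.isZmodule.Build dual dual_addA dual_addC dual_add0 dual_addN.

Section Scale.
Variables (s : S) (f : dual).

Definition dual_scale_fun (v : V) : S^o := (f v : S) * s.

Fact dual_scale_is_linear : linear dual_scale_fun.
Proof.
move=> a u v; rewrite /dual_scale_fun linearP mulrDl; congr (_ + _).
by rewrite /GRing.scale /= mulrA.
Qed.
HB.instance Definition _ :=
  GRing.isLinear.Build S V S^o _ dual_scale_fun dual_scale_is_linear.

Definition dual_scale : dual := dual_scale_fun.
End Scale.
End Dual.

Section Bass.
Variable R : pzRingType.

(* A^* for a right module A; it is a left module via (r f)(a) = r f(a). *)
Definition rdual (A : lmodType R^c) : Type := dual A.
HB.instance Definition _ (A : lmodType R^c) := GRing.Zmodule.on (rdual A).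

Definition rdual_scale (A : lmodType R^c) (r : R) (f : rdual A) : rdual A :=
  dual_scale (r : R^c) f.

Section RDual.
Variable A : lmodType R^c.
Fact rdual_scaleA (r s : R) (f : rdual A) :
  rdual_scale r (rdual_scale s f) = rdual_scale (r * s) f.
Proof. by apply: dualP => a; apply: (@mulrA R). Qed.
Fact rdual_scale1 : left_id 1 (@rdual_scale A).
Proof. by move=> f; apply: dualP => a; apply: (@mul1r R). Qed.
Fact rdual_scaleDr : right_distributive (@rdual_scale A) +%R.
Proof. by move=> r f g; apply: dualP => a; apply: (@mulrDr R). Qed.
Fact rdual_scaleDl (f : rdual A) :
  {morph (fun r : R => rdual_scale r f) : r s / r + s}.
Proof. by move=> r s; apply: dualP => a; apply: (@mulrDl R). Qed.
HB.instance Definition _ := GRing.Zmodule_isLmodule.Build R (rdual A)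
  rdual_scaleA rdual_scale1 rdual_scaleDr rdual_scaleDl.
End RDual.

(* M^* for a left module M; it is a right module via (f r)(m) = f(m) r. *)
Definition ldual (M : lmodType R) : Type := dual M.
HB.instance Definition _ (M : lmodType R) := GRing.Zmodule.on (ldual M).

Definition ldual_scale (M : lmodType R) (r : R^c) (f : ldual M) : ldual M :=
  dual_scale (r : R) f.

Section LDual.
Variable M : lmodType R.
Fact ldual_scaleA (r s : R^c) (f : ldual M) :
  ldual_scale r (ldual_scale s f) = ldual_scale (r * s) f.
Proof. by apply: dualP => m; apply/esym/(@mulrA R). Qed.
Fact ldual_scale1 : left_id 1 (@ldual_scale M).
Proof. by move=> f; apply: dualP => m; apply: (@mulr1 R). Qed.
Fact ldual_scaleDr : right_distributive (@ldual_scale M) +%R.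
Proof. by move=> r f g; apply: dualP => m; apply: (@mulrDl R). Qed.
Fact ldual_scaleDl (f : ldual M) :
  {morph (fun r : R^c => ldual_scale r f) : r s / r + s}.
Proof. by move=> r s; apply: dualP => m; apply: (@mulrDr R). Qed.
HB.instance Definition _ := GRing.Zmodule_isLmodule.Build R^c (ldual M)
  ldual_scaleA ldual_scale1 ldual_scaleDr ldual_scaleDl.
End LDual.

Variable A : lmodType R^c.

Section Eval.
Variable a : A.

Definition eval_at (f : rdual A) : R^o := f a.
Fact eval_at_is_linear : linear eval_at.
Proof. by []. Qed.
HB.instance Definition _ :=
  GRing.isLinear.Build R (rdual A) R^o _ eval_at eval_at_is_linear.
End Eval.

(* e_A : A -> A^** *)
Definition eval_bidual (a : A) : ldual (rdual A) := eval_at a.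

Fact eval_bidual_is_linear : linear eval_bidual.
Proof. by move=> r a b; apply: dualP => f; apply: (linearP f). Qed.
HB.instance Definition _ := GRing.isLinear.Build R^c A (ldual (rdual A)) _
  eval_bidual eval_bidual_is_linear.

Definition bass_torsion : set A := [set a | eval_bidual a = 0].

(* A is the cokernel of a map R^m -> R^n of free right modules. *)
Definition finitely_presented : Prop :=
  exists m n (d : {linear 'rV[R^c]_m -> 'rV[R^c]_n})
             (p : {linear 'rV[R^c]_n -> A}),
    (forall a, exists v, p v = a) /\
    (forall v, p v = 0 <-> exists u, d u = v).

End Bass.

Arguments bass_torsion {R} A.

Section InjectiveEnvelope.
Variable R : pzRingType.

Definition injective_module (I : lmodType R) : Prop :=
  forall (M N : lmodType R) (j : {linear M -> N}) (f : {linear M -> I}),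
    injective j -> exists g : {linear N -> I}, forall x, g (j x) = f x.

(* j is injective and every nonzero submodule of N meets its image. *)
Definition essential_mono (M N : lmodType R) (j : {linear M -> N}) : Prop :=
  injective j /\
  forall S : {pred N}, GRing.submod_closed S ->
    (exists2 y, y \in S & y != 0) -> exists2 x, j x \in S & j x != 0.

Definition injective_envelope (M I : lmodType R) (iota : {linear M -> I}) : Prop :=
  injective_module I /\ essential_mono iota.

End InjectiveEnvelope.

(* Main.v *)
(* An element a lies in s(A) iff a (x) iota(1) = 0 in A (x) I.  Applying
   f (x) 1 : A (x) I -> I for f in A^* turns this into iota(f(a)) = 0, so
   s(A) <= t(A) for every A.  Conversely let A be the cokernel of a matrix
   D : R^m -> R^n, and let v in R^n represent a in t(A).  A row w with w D = 0
   is an element of A^*, hence w v = 0; so w D |-> iota(w v) is a well-defined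
   left-linear map on the row space of D, and by injectivity it extends to
   g : R^m -> I.  With y_j := g(e_j) this says iota(v_i) = sum_j D_ij y_j,
   whence a (x) iota(1) = sum_j p(D e_j) (x) y_j = 0. *)
Require Import Defs.
From HB Require Import structures.
From mathcomp Require Import all_boot all_algebra.
From mathcomp Require Import boolp classical_sets.
Import GRing.Theory.
Local Open Scope ring_scope.

Set Implicit Arguments.
Unset Strict Implicit.
Unset Printing Implicit Defensive.

(** Choose a set-theoretic section [s] of [p]. As [s (p v)] and [v] differ by an element of the
    kernel of [p], [k] agrees on them, and this makes [k \o s] linear although [s] need not be. *)
Lemma linear_factor_surj (S : pzRingType) (V A W : lmodType S)
    (p : {linear V -> A}) (k : {linear V -> W}) :
  (forall a, exists v, p v = a) -> (forall v, p v = 0 -> k v = 0) ->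
  exists F : {linear A -> W}, forall v, F (p v) = k v.
Proof.
move=> /choice[s sK] ker_pk.
have ksp v : k (s (p v)) = k v.
  by apply/eqP; rewrite -subr_eq0 -linearB ker_pk // linearB /= sK subrr.
have linF : linear (k \o s).
  by move=> c a b /=; rewrite -{1}(sK a) -{1}(sK b) -linearP ksp linearP.
pose FL := GRing.isLinear.Build S A W _ (k \o s) linF.
pose F : {linear A -> W} := HB.pack (k \o s) FL.
by exists F => v; apply: ksp.
Qed.

Section Range.
Variables (S : pzRingType) (M N : lmodType S) (f : {linear M -> N}).

Definition linear_range : {pred N} := fun y => `[< exists x, f x = y >].

Fact linear_range_submod_closed : GRing.submod_closed linear_range.
Proof.
split=> [|c _ _ /asboolP[x <-] /asboolP[y <-]]; apply/asboolP.
  by exists 0; rewrite linear0.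
by exists (c *: x + y); rewrite linearP.
Qed.
HB.instance Definition _ :=
  GRing.isSubmodClosed.Build S N linear_range linear_range_submod_closed.

(** The image of [f] is made a module of its own because [injective_module] extends maps along
    injective linear maps between modules; here that map is the inclusion [val]. *)
Record range_module := RangeModule {
  range_val :> N; _ : range_val \in linear_range }.
HB.instance Definition _ := [isSub for range_val].
HB.instance Definition _ := [Choice of range_module by <:].
HB.instance Definition _ := [SubChoice_isSubLmodule of range_module by <:].

Fact range_valP x : f x \in linear_range.
Proof. by apply/asboolP; exists x. Qed.

Definition to_range (x : M) : range_module := RangeModule (range_valP x).

Fact to_range_is_linear : linear to_range.
Proof. by move=> c x y; apply/val_inj; rewrite linearP /= linearP. Qed.
HB.instance Definition _ :=
  GRing.isLinear.Build S M range_module _ to_range to_range_is_linear.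

Lemma to_range_surj (y : range_module) : exists x, to_range x = y.
Proof. by case: y => y /[dup] /asboolP[x <-] yP; exists x; apply/val_inj. Qed.

End Range.

(** The map [h] descends to the image of [f], and the descended map extends along the inclusion of
    that image in [N]. *)
Lemma injective_module_extend (S : pzRingType) (I M N : lmodType S)
    (f : {linear M -> N}) (h : {linear M -> I}) :
  injective_module I -> (forall x, f x = 0 -> h x = 0) ->
  exists g : {linear N -> I}, forall x, g (f x) = h x.
Proof.
move=> injI ker_fh.
have [|h' h'E] := linear_factor_surj (k := h) (@to_range_surj _ _ _ f).
  by move=> x /(congr1 val); rewrite linear0 => /ker_fh.
have [g gE] := injI _ _ (val : {linear range_module f -> N}) h' val_inj.
by exists g => x; rewrite -h'E -gE.
Qed.

Section Torsion.
Variables (R : pzRingType) (I : lmodType R) (iota : {linear R^o -> I}).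
Variable A : lmodType R^c.

Lemma tens0r (a : A) : tens a (0 : I) = 0.
Proof. by apply: (addrI (tens a 0)); rewrite -tensDr !addr0. Qed.

Lemma tens0l (m : I) : tens (0 : A) m = 0.
Proof. by apply: (addrI (tens 0 m)); rewrite -tensDl !addr0. Qed.

Lemma tens_suml n (a : 'I_n -> A) (m : I) :
  tens (\sum_i a i) m = \sum_i tens (a i) m.
Proof.
exact: (big_morph (fun a => tens a m) (fun a b => tensDl a b m) (tens0l m)).
Qed.

Lemma tens_sumr n (a : A) (m : 'I_n -> I) :
  tens a (\sum_i m i) = \sum_i tens a (m i).
Proof. exact: (big_morph _ (tensDr a) (tens0r a)). Qed.

Lemma injective_torsionP (a : A) :
  injective_torsion A iota a <-> tens a (iota 1) = 0.
Proof.
split=> [[t /= t0 <-]|a0]; last first.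
  by exists (tens a (1 : R^o)); rewrite /= ?tensor_mapE // tensor_unitE scale1r.
(* Both sides are additive in [t], so pure tensors [tens b r] suffice; there the identity is
   [iota r = r *: iota 1], with [r] moved across the tensor. *)
suff <- : tensor_map iota t = tens (tensor_unit t) (iota 1) by [].
pose g (t : tensor A R^o) : tensor A I := tens (tensor_unit t) (iota 1).
have addg : zmod_morphism g.
  by move=> x y; apply/eqP; rewrite eq_sym subr_eq /g -tensDl -raddfD addrNK.
pose gA := GRing.isZmodMorphism.Build _ _ g addg.
pose ga : {additive _ -> _} := HB.pack g gA.
apply: (@tensor_ext _ _ _ _ (tensor_map iota) ga) => b r.
rewrite /= tensor_mapE /g tensor_unitE tensZ -linearZ.
by congr (tens _ (iota _)); rewrite /GRing.scale /= mulr1.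
Qed.

Lemma injective_torsion_sub_bass :
  injective iota -> (injective_torsion A iota `<=` bass_torsion A)%classic.
Proof.
move=> inj_iota a /injective_torsionP a0; apply: dualP => f.
apply: inj_iota; rewrite linear0.
(* The induced map from the tensor product to [I] sends [tens a (iota 1)] to
   [f a *: iota 1 = iota (f a)]. *)
have bal : balanced (fun (b : A) (m : I) => (f b : R) *: m).
  split=> [b b' m|b m m'|b r m]; rewrite ?linearD ?scalerDl ?scalerDr //.
  by rewrite linearZ /= scalerA.
have := tensor_liftE bal a (iota 1); rewrite a0.
have -> : tensor_lift (fun (b : A) (m : I) => (f b : R) *: m) (0 : tensor A I) = 0.
  have add := tensor_lift_is_additive bal.
  by have := add 0 0; rewrite !subrr.
move=> /esym <-; rewrite -linearZ; congr (iota _).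
by rewrite /GRing.scale /= mulr1.
Qed.

Lemma bass_sub_injective_torsion : injective_module I ->
  finitely_presented A -> (bass_torsion A `<=` injective_torsion A iota)%classic.
Proof.
move=> injI [m [n [d [p [p_surj p_ker]]]]] a a0; apply/injective_torsionP.
have [v pv] := p_surj a; rewrite -{a}pv in a0 *.
(* Right vectors are stored as rows over [R^c] but behave as columns over [R]: column [j] of [D] is
   the image under [d] of the [j]-th basis vector, and [d] acts by [D] on the left. *)
pose D : 'M[R]_(n, m) := \matrix_(i, j) (d (delta_mx 0 j) 0 i : R).
have dE u i : d u 0 i = \sum_j D i j * (u 0 j : R) :> R.
  rewrite [in LHS](row_sum_delta u) linear_sum summxE.
  by apply: eq_bigr => j _; rewrite linearZ !mxE.
pose pair (w : 'rV[R]_n) (u : 'rV[R^c]_n) : R := \sum_i w 0 i * (u 0 i : R).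
have pair_linl u : linear (fun w => pair w u : R^o).
  move=> c x y; rewrite /pair scaler_sumr -big_split /=.
  apply: eq_bigr => i _; rewrite !mxE mulrDl; congr (_ + _).
  exact/esym/mulrA.
have pair_linr w : linear (fun u => pair w u : R^c^o).
  move=> c x y; rewrite /pair scaler_sumr -big_split /=.
  apply: eq_bigr => i _; rewrite !mxE mulrDr; congr (_ + _).
  exact: (@mulrA R).
(* If [w *m D = 0], then [pair w] vanishes on the range of [d], which is the kernel of [p]. It thus
   descends to some [f] in the dual of [A], and [f (p v) = 0] by Bass torsion. *)
have ker_v (w : 'rV[R]_n) : w *m D = 0 -> iota (pair w v) = 0.
  move=> wD0.
  pose kL := GRing.isLinear.Build R^c _ R^c^o _ (fun u => pair w u) (pair_linr w).
  pose k : {linear 'rV[R^c]_n -> R^c^o} := HB.pack (fun u => pair w u : R^c^o) kL.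
  have [|f fE] := linear_factor_surj (k := k) p_surj.
    move=> _ /p_ker[u <-]; rewrite /k /= /pair.
    under eq_bigr do rewrite dE mulr_sumr.
    rewrite exchange_big big1 // => j _.
    under eq_bigr do rewrite mulrA.
    rewrite -mulr_suml; move/matrixP/(_ 0 j): wD0; rewrite !mxE => ->.
    by rewrite mul0r.
  have /(congr1 (fun e : ldual (rdual A) => e (f : rdual A))) := a0.
  by rewrite /= /eval_at fE /k /= => ->; rewrite linear0.
have lin_h : linear (fun w => iota (pair w v)).
  by move=> c x y; rewrite pair_linl linearP.
pose hL := GRing.isLinear.Build R _ I _ _ lin_h.
pose h : {linear 'rV[R]_n -> I} := HB.pack (fun w => iota (pair w v)) hL.
have [g gE] := injective_module_extend (f := mulmxr D) (h := h) injI ker_v.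
pose y j := g (delta_mx 0 j).
have iota_v i : iota (v 0 i : R) = \sum_j D i j *: y j.
  have := gE (delta_mx 0 i); rewrite /h /= -rowE /pair (bigD1 i) //=.
  rewrite big1 => [|k ki]; last by rewrite mxE eqxx (negPf ki) mul0r.
  rewrite mxE !eqxx mul1r addr0 => <-.
  rewrite (row_sum_delta (row i D)) linear_sum.
  by apply: eq_bigr => j _; rewrite linearZ mxE.
(* Expand [p v] over the basis, move each coordinate of [v] across the tensor, substitute [iota_v],
   and move the entries of [D] back to the left factor. *)
rewrite [in LHS](row_sum_delta v) linear_sum tens_suml.
under eq_bigr => i _.
  rewrite linearZ tensZ -linearZ.
  rewrite (_ : (v 0 i : R) *: (1 : R^o) = v 0 i); last exact: mulr1.
  rewrite iota_v tens_sumr.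
  under eq_bigr do rewrite -tensZ -linearZ.
  over.
rewrite exchange_big big1 // => j _; rewrite -tens_suml -linear_sum.
(* The sum is column [j] of [D], that is [d (delta_mx 0 j)], which [p] kills. *)
suff -> : p (\sum_i (D i j : R^c) *: delta_mx 0 i) = 0 by rewrite tens0l.
apply/p_ker; exists (delta_mx 0 j); rewrite [LHS]row_sum_delta.
by apply: eq_bigr => i _; rewrite mxE.
Qed.

End Torsion.

Theorem proposition2p13 (R : pzRingType) (I : lmodType R)
    (iota : {linear R^o -> I}) (iota_env : injective_envelope iota)
    (A : lmodType R^c) (A_fp : finitely_presented A) :
  injective_torsion A iota = bass_torsion A :> set A.
Proof.
case: iota_env => injI [inj_iota _]; apply/seteqP; split.
  exact: injective_torsion_sub_bass.
exact: bass_sub_injective_torsion.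
Qed.
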